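(* Let $(X,\mathcal A)$ be a measurable space with a probability measure $m$, and let $(K_n)_{n\in\mathbb Z}$ be Markov kernels on $X$ of the form $K_n(x,dy)=k_n(x,y)\,m(dy)$, with transfer operators $(L_nf)(y)=\int_Xf(x)k_n(x,y)\,dm(x)$ on $L^1(m)$. Assume that there exists $\alpha\in(0,1]$ such that for every $n\in\mathbb Z$, every $x\in X$ and every $A\in\mathcal A$, $$K_n(x,A)\ge\alpha\,m(A).$$ Then for all integers $p<n$ and all $f,g\in L^1(m)$ with $\int f\,dm=\int g\,dm$, $$\bigl\|L_{n-1}\cdots L_p(f-g)\bigr\|_{L^1(m)}\le(1-\alpha)^{\,n-p}\,\|f-g\|_{L^1(m)}.$$ In particular, the sequential system $(L_n)$ has exponential loss of memory on the zero-mean subspace $L^1_0(m):=\{h\in L^1(m):\int h\,dm=0\}$, i.e. $\|L_{n-1}\cdots L_ph\|_{L^1(m)}\le(1-\alpha)^{n-p}\|h\|_{L^1(m)}$ for all $h\in L^1_0(m)$.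
   Context: Absolutely continuous measures $\mu\ll m$ are identified with their densities. $k_n$ is a jointly measurable nonnegative kernel with $\int k_n(x,y)\,dm(y)=1$. *)

(* Defs.v *)
From HB Require Import structures.
From mathcomp Require Import all_boot all_order all_algebra.
From mathcomp Require Import all_classical all_reals all_analysis.
From mathcomp Require Import measurable_realfun.

Set Implicit Arguments.
Unset Strict Implicit.
Unset Printing Implicit Defensive.
Import Order.TTheory GRing.Theory Num.Theory.
Import numFieldNormedType.Exports.

Local Open Scope classical_set_scope.
Local Open Scope ring_scope.

Section transfer.
Context d (X : measurableType d) (R : realType) (m : probability X R).

Record markov_density (k : X * X -> R) : Prop := MarkovDensity {
  markov_density_measurable : measurable_fun [set: X * X] k ;
  markov_density_ge0 : forall z, 0 <= k z ;
  markov_density_int1 : forall x, (\int[m]_y (k (x, y))%:E = 1)%E }.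

(* L^1(m) is represented by the integrable functions [Lfun m 1]. For f in    *)
(* L^1(m) the integral below converges for m-almost every y; at the other    *)
(* points [Rintegral] gives a junk value. Lemmas [transfer_Lfun] and         *)
(* [transfer_ae_eq] show that this induces an operator on classes modulo     *)
(* m-a.e. equality.                                                          *)
Definition transfer (k : X * X -> R) (f : X -> R) : X -> R :=
  fun y => \int[m]_x (f x * k (x, y)).

(* L_(p+j-1) \o ... \o L_p, where L_i is the transfer operator of k i *)
Fixpoint transfer_iter (k : int -> X * X -> R) (p : int) (j : nat)
    (f : X -> R) : X -> R :=
  if j is i.+1 then transfer (k (p + i%:Z)) (transfer_iter k p i f) else f.

(* L_(n-1) \o ... \o L_p, meaningful only for p <= n *)
Definition transfer_prod (k : int -> X * X -> R) (p n : int) :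
    (X -> R) -> X -> R :=
  transfer_iter k p `|n - p|%N.

Definition zero_mean : set (X -> R) :=
  [set h | h \in Lfun m 1 /\ \int[m]_x h x = 0].

Lemma transfer_integrand_measurable k f : markov_density k ->
  f \in Lfun m 1 ->
  measurable_fun [set: X * X] (EFin \o (fun z : X * X => f z.1 * k z)).
Proof.
move=> [mk _ _] /sub_Lfun_mfun /[!inE] /= mf.
apply/measurable_EFinP; apply: measurable_funM => //.
exact: (measurableT_comp mf).
Qed.

Lemma transfer_Lfun k f : markov_density k ->
  f \in Lfun m 1 -> transfer k f \in Lfun m 1.
Proof.
move=> dk f1; have mF := transfer_integrand_measurable dk f1.
case: dk => mk k0 k1.
have /integrableP[mf fy] := (Lfun1_integrable m f).1 f1.
have iF : (m \x m)%E.-integrable setT (EFin \o (fun z : X * X => f z.1 * k z)).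
  apply/integrable12ltyP => //=.
  apply: le_lt_trans fy; rewrite le_eqVlt; apply/orP; left; apply/eqP.
  apply: eq_integral => x _ /=.
  under eq_integral do rewrite normrM (ger0_norm (k0 _)) EFinM.
  rewrite ge0_integralZl//; first by rewrite k1 mule1.
  - by apply/measurable_EFinP; exact: (measurableT_comp mk).
  - by move=> y _; rewrite lee_fin.
have mG := measurable_fubini_G iF.
apply/Lfun1_integrable/integrableP; split.
  by apply/measurable_EFinP; exact: (measurableT_comp _ mG).
have := (integrable21ltyP m m mF).1 iF; apply: le_lt_trans.
apply: ge0_le_integral => //.
- apply: measurableT_comp => //; apply/measurable_EFinP.
  exact: (measurableT_comp _ mG).
- apply: (measurable_fun_fubini_tonelli_G
    (abse \o (EFin \o (fun z : X * X => f z.1 * k z)))) => //=.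
  exact: measurableT_comp.
- move=> y _; apply: (@le_trans _ _ `|fubini_G m
    (EFin \o (fun z : X * X => f z.1 * k z)%R) y|%E); last first.
    apply: le_abse_integral => //; exact: (measurableT_comp mF).
  rewrite /transfer /Rintegral /fubini_G/=.
  by case: (integral _ _ _) => [r| |] //=; rewrite normr0 leey.
Qed.

Lemma transfer_ae_eq k f g : markov_density k ->
  f \in Lfun m 1 -> g \in Lfun m 1 -> f = g %[ae m] ->
  transfer k f = transfer k g.
Proof.
move=> dk f1 g1 fg; apply/funext => y; congr fine.
have mF := transfer_integrand_measurable dk f1.
have mG := transfer_integrand_measurable dk g1.
apply: ae_eq_integral => //.
- exact: (measurableT_comp mF (pair2_measurable y)).
- exact: (measurableT_comp mG (pair2_measurable y)).
- by apply: filterS fg => x /= /(_ I) ->.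
Qed.

Lemma transfer_prod_Lfun k p n f : (forall i, markov_density (k i)) ->
  f \in Lfun m 1 -> transfer_prod k p n f \in Lfun m 1.
Proof.
rewrite /transfer_prod => dk f1; elim: `|n - p|%N => //= j ih.
exact: transfer_Lfun.
Qed.

End transfer.

(* Main.v *)
Require Import Defs.
From mathcomp Require Import all_boot all_order all_algebra.
From mathcomp Require Import all_classical all_reals all_analysis.
From mathcomp Require Import measurable_realfun.

Import Order.TTheory GRing.Theory Num.Theory.
Import numFieldNormedType.Exports.
Local Open Scope classical_set_scope.
Local Open Scope ring_scope.

(** If [h] has zero mean, subtracting a constant from the kernel does not
    change [transfer m k h y = \int[m]_x (h x * k (x, y))]; hence
    [`|transfer m k h y| <= \int[m]_x (`|h x| * `|k (x, y) - alpha|)]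
    ([normr_transfer_le]). Integrating in [y] and exchanging the integrals
    by Tonelli, the L^1 norm of [transfer m k h] is at most the integral of
    [`|h x| * \int[m]_y `|k (x, y) - alpha|]. The minorization of the
    transition probabilities by [alpha * m] says that, for each [x],
    [k (x, y) - alpha] has nonnegative integral over every measurable set of
    [y]; its absolute value therefore integrates to the same value as itself,
    namely [1 - alpha] ([integral_density_dist]). So one step contracts the
    norm by [1 - alpha] ([Lnorm1_transfer_le]).

    By Fubini a transfer operator preserves the mean ([Rintegral_transfer]),
    so the zero-mean functions are stable and the one-step estimate iterates
    ([Lnorm1_transfer_iter_le]). The statement on pairs [f], [g] is the case
    [h = f - g]. *)

(** The integral over [{w < 0}] is both nonpositive and, by assumption,
    nonnegative, so the negative part of [w] has zero integral. Testing [w]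
    against sets in this way replaces the statement that [w] is nonnegative
    almost everywhere. *)
Lemma integral_abse_of_integral_ge0 d (T : measurableType d) (R : realType)
    (mu : measure T R) (w : T -> \bar R) :
  mu.-integrable setT w ->
  (forall A, measurable A -> (0 <= \int[mu]_(x in A) w x)%E) ->
  (\int[mu]_x `|w x| = \int[mu]_x w x)%E.
Proof.
move=> iw w0; have mw := measurable_int mu iw.
pose N := [set x | (w x < 0)%E].
have mN : measurable N.
  by rewrite -[N]setTI; exact: emeasurable_fun_infty_o.
have neg0 : (\int[mu]_x w^\- x = 0)%E.
  have negE : (\int[mu]_x w^\- x = - \int[mu]_(x in N) w x)%E.
    rewrite -integralN; last first.
      by apply: integrable_add_def => //; exact: integrableS iw.
    rewrite [RHS]integral_mkcond; apply: eq_integral => x _.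
    rewrite funenegE patchE; case: ifPn => xN.
      by rewrite max_l// oppe_ge0 ltW//; exact: (set_mem xN).
    apply: max_r; rewrite oppe_le0 leNgt; apply/negP => wx.
    by move/negP: xN; apply; exact: mem_set.
  by apply/eqP; rewrite eq_le integral_ge0// andbT negE oppe_le0 w0.
have -> : (\int[mu]_x `|w x| = \int[mu]_x (w^\+ x + w^\- x))%E.
  by apply: eq_integral => x _; rewrite -[in LHS]/((abse \o w) x) fune_abse.
rewrite ge0_integralD// ?neg0 ?adde0; last 2 first.
- exact: measurable_funepos.
- exact: measurable_funeneg.
by rewrite [RHS]integralE neg0 sube0.
Qed.

Section one_step.
Context d (X : measurableType d) (R : realType) (m : probability X R).
Variables (k : X * X -> R) (alpha : R).
Hypothesis dk : markov_density m k.

Let mk1 x : measurable_fun setT (fun y => k (x, y)).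
Proof. exact: (measurableT_comp (markov_density_measurable dk)). Qed.

Let mk2 y : measurable_fun setT (fun x => k (x, y)).
Proof. exact: (measurableT_comp (markov_density_measurable dk)). Qed.

Let ik x : m.-integrable setT (EFin \o (fun y => k (x, y))).
Proof.
apply/integrableP; split; first exact/measurable_EFinP.
under eq_integral do rewrite /= ger0_norm ?(markov_density_ge0 dk)//.
by rewrite (markov_density_int1 dk) ltry.
Qed.

(** Fubini on [f x * k (x, y)]: the inner integral over [y] is [f x]. *)
Lemma Rintegral_transfer f : f \in Lfun m 1 ->
  \int[m]_y transfer m k f y = \int[m]_x f x.
Proof.
move=> f1; have mF := transfer_integrand_measurable dk f1.
have f_int := (Lfun1_integrable m f).1 f1.
have iF : (m \x m)%E.-integrable setT (EFin \o (fun z : X * X => f z.1 * k z)).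
  apply/integrable12ltyP => //=.
  have /integrableP[_] := f_int; apply: le_lt_trans.
  rewrite le_eqVlt; apply/orP; left; apply/eqP.
  apply: eq_integral => x _ /=.
  under eq_integral do
    rewrite normrM (ger0_norm (markov_density_ge0 dk _)) EFinM.
  rewrite ge0_integralZl//; first by rewrite (markov_density_int1 dk) mule1.
  - exact/measurable_EFinP.
  - by move=> y _; rewrite lee_fin (markov_density_ge0 dk).
have mG := measurable_fubini_G iF.
congr fine.
(* [transfer] takes the finite part of the inner integral, which agrees with
   that integral only where it converges, that is for almost every [y]. *)
transitivity (\int[m]_y fubini_G m (EFin \o (fun z => f z.1 * k z)%R) y)%E.
  apply: ae_eq_integral => //.
    by apply/measurable_EFinP; exact: (measurableT_comp _ mG).
  apply: filterS (ae_integrable2 iF) => y iy _ /=.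
  by rewrite fineK//; exact: integrable_fin_num.
rewrite integral21_prod_meas1// -integral12_prod_meas1//.
apply: eq_integral => x _; rewrite /fubini_F /=.
under eq_integral do rewrite EFinM.
by rewrite (integralZl _ (ik x))// (markov_density_int1 dk) mule1.
Qed.

(** The bound holds at every [y], not just almost everywhere: where the
    integral defining [transfer] diverges, so does the right-hand side. *)
Lemma normr_transfer_le f y : f \in Lfun m 1 -> \int[m]_x f x = 0 ->
  (`|transfer m k f y|%:E <= \int[m]_x `|f x * (k (x, y) - alpha)|%:E)%E.
Proof.
move=> f1 f0; have f_int := (Lfun1_integrable m f).1 f1.
have mf : measurable_fun setT f.
  by apply/measurable_EFinP; exact: measurable_int f_int.
pose g x := f x * (k (x, y) - alpha).
have mg : measurable_fun setT g.
  by apply: measurable_funM => //; exact: measurable_funB.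
have [goo|] := ltP (\int[m]_x `|(g x)%:E|)%E +oo%E; last first.
  by rewrite leye_eq => /eqP /= ->; rewrite leey.
have g_int : m.-integrable setT (EFin \o g).
  by apply/integrableP; split => //; exact/measurable_EFinP.
have fa_int : m.-integrable setT (EFin \o (fun x => f x * alpha)).
  exact: (integrableZr measurableT alpha f_int).
have -> : transfer m k f y = \int[m]_x g x.
  transitivity (\int[m]_x (g x + f x * alpha)).
    by apply: eq_Rintegral => x _; rewrite /g mulrBr subrK.
  by rewrite RintegralD// RintegralZr// f0 mul0r addr0.
rewrite EFin_normr_Rintegral//.
by apply: le_abse_integral => //; exact/measurable_EFinP.
Qed.

Hypothesis minor : forall x A, measurable A ->
  (alpha%:E * m A <= \int[m]_(y in A) (k (x, y))%:E)%E.

(** The constant [alpha] is the right one to subtract: it lies below the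
    density for almost every [y], so nothing cancels in the absolute value.
    The distance of the density to [1] is only bounded by [2 * (1 - alpha)],
    which would lose a factor 2 at every step. *)
Lemma integral_density_dist x :
  (\int[m]_y `|k (x, y) - alpha|%:E = (1 - alpha)%:E)%E.
Proof.
have ia A : measurable A -> m.-integrable A (EFin \o cst alpha).
  exact: finite_measure_integrable_cst.
have iB A : measurable A ->
  (\int[m]_(y in A) ((k (x, y))%:E - alpha%:E) =
   \int[m]_(y in A) (k (x, y))%:E - alpha%:E * m A)%E.
  move=> mA; rewrite (integralB_EFin _ _ (ia A mA))//; last first.
    exact: integrableS (ik x).
  by rewrite -(integral_cst m mA).
transitivity (\int[m]_y ((k (x, y))%:E - alpha%:E))%E; last first.
  by rewrite iB// (markov_density_int1 dk) probability_setT mule1.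
pose w y := ((k (x, y))%:E - alpha%:E)%E.
apply: (integral_abse_of_integral_ge0 _ _ _ _ w).
  exact: integrableB (ik x) (ia _ measurableT).
move=> A mA; rewrite iB// sube_ge0 ?minor//.
by apply/orP; left; rewrite fin_numM// fin_num_measure.
Qed.

Lemma Lnorm1_transfer_le f : f \in Lfun m 1 -> \int[m]_x f x = 0 ->
  ('N[m]_1[EFin \o transfer m k f]
    <= (1 - alpha)%:E * 'N[m]_1[EFin \o f])%E.
Proof.
move=> f1 f0.
have mf : measurable_fun setT f.
  apply/measurable_EFinP; exact: measurable_int ((Lfun1_integrable m f).1 f1).
have mL : measurable_fun setT (transfer m k f).
  apply/measurable_EFinP.
  exact: measurable_int ((Lfun1_integrable m _).1 (transfer_Lfun dk f1)).
pose G (z : X * X) := (`|f z.1 * (k z - alpha)|%:E)%E.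
have mG : measurable_fun setT G.
  apply/measurable_EFinP; apply: measurableT_comp => //.
  apply: measurable_funM; first exact: (measurableT_comp mf).
  by apply: measurable_funB => //; exact: markov_density_measurable dk.
have G0 z : (0 <= G z)%E by rewrite lee_fin.
rewrite !Lnorm1.
apply: (@le_trans _ _ (\int[m]_y \int[m]_x G (x, y))%E).
  apply: ge0_le_integral => //.
  - by apply/measurable_EFinP; exact: measurableT_comp.
  - exact: measurable_fun_fubini_tonelli_G.
  - by move=> y _; exact: normr_transfer_le.
rewrite -sfinite_Fubini//.
rewrite -integralZl//; last exact: integrable_abse ((Lfun1_integrable m f).1 f1).
rewrite le_eqVlt; apply/orP; left; apply/eqP.
apply: eq_integral => x _; rewrite /G /=.
under eq_integral do rewrite normrM EFinM.
rewrite ge0_integralZl//; first by rewrite integral_density_dist muleC.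
apply/measurable_EFinP; apply: measurableT_comp => //.
exact: measurable_funB.
Qed.

End one_step.

(** The mean of each iterate is carried along because the one-step
    contraction fails for functions of nonzero mean: the constant 1 may be
    fixed by every transfer operator. *)
Lemma Lnorm1_transfer_iter_le d (X : measurableType d) (R : realType)
    (m : probability X R) (k : int -> X * X -> R) (alpha : R) :
  alpha <= 1 -> (forall i, markov_density m (k i)) ->
  (forall i x A, measurable A ->
     (alpha%:E * m A <= \int[m]_(y in A) (k i (x, y))%:E)%E) ->
  forall p j h, zero_mean m h ->
  zero_mean m (transfer_iter m k p j h) /\
  ('N[m]_1[EFin \o transfer_iter m k p j h]
    <= ((1 - alpha) ^+ j)%:E * 'N[m]_1[EFin \o h])%E.
Proof.
move=> a1 dk minor p j h h0.
elim: j => [|j [[Lj Ij] IH]]; first by rewrite expr0 mul1e.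
split.
  by split; [exact: transfer_Lfun|rewrite /= Rintegral_transfer].
apply: (le_trans (Lnorm1_transfer_le _ _ _ _ _ _ (dk _) (minor _) _ Lj Ij)).
by rewrite exprS EFinM -muleA lee_wpmul2l// lee_fin subr_ge0.
Qed.

Theorem theorem31 (R : realType) (d : measure_display) (X : measurableType d)
  (m : probability X R)
  (K : int -> R.-pker X ~> X) (k : int -> X * X -> R)
  (hk : forall n : int, markov_density m (k n))
  (hK : forall (n : int) (x : X) (A : set X), measurable A ->
     K n x A = (\int[m]_(y in A) (k n (x, y))%:E)%E)
  (alpha : R) (halpha : 0 < alpha <= 1)
  (hmin : forall (n : int) (x : X) (A : set X), measurable A ->
     (alpha%:E * m A <= K n x A)%E) :
  (forall (p n : int) (f g : X -> R), p < n ->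
     f \in Lfun m 1 -> g \in Lfun m 1 ->
     \int[m]_x f x = \int[m]_x g x ->
     ('N[m]_1[EFin \o transfer_prod m k p n (f \- g)%R]
       <= ((1 - alpha) ^ (n - p))%:E * 'N[m]_1[EFin \o (f \- g)%R])%E)
  /\
  (forall (p n : int) (h : X -> R), p < n -> zero_mean m h ->
     ('N[m]_1[EFin \o transfer_prod m k p n h]
       <= ((1 - alpha) ^ (n - p))%:E * 'N[m]_1[EFin \o h])%E).
Proof.
have minor i x A : measurable A ->
    (alpha%:E * m A <= \int[m]_(y in A) (k i (x, y))%:E)%E.
  by move=> mA; rewrite -hK// hmin.
have a1 : alpha <= 1 by case/andP: halpha.
have loss p n h : p < n -> zero_mean m h ->
    ('N[m]_1[EFin \o transfer_prod m k p n h]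
       <= ((1 - alpha) ^ (n - p))%:E * 'N[m]_1[EFin \o h])%E.
  move=> pn h0; have -> : n - p = `|n - p|%N :> int.
    by rewrite gez0_abs// subr_ge0 ltW.
  exact: (Lnorm1_transfer_iter_le _ _ _ _ _ _ a1 hk minor p _ h h0).2.
split=> // p n f g pn f1 g1 fg; apply: loss => //; split.
  by apply: rpredB.
rewrite RintegralB//; first by rewrite fg subrr.
- exact/Lfun1_integrable.
- exact/Lfun1_integrable.
Qed.
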